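(* There exist RAC graphs that are not fan-crossing.
   Context: All graphs are simple. Drawings are in the plane, with vertices as distinct points and edges as Jordan arcs not passing through vertices; drawings are simple: adjacent edges do not cross and two edges cross at most once. A graph is RAC if it admits a drawing with straight-line edges in which any two crossing edges cross at a right angle. A graph is fan-crossing if it admits a drawing in which, for every edge $e$, all edges crossing $e$ have a common endpoint. *)

(* Defs.v *)
From HB Require Import structures.
From mathcomp Require Import all_boot all_order all_algebra.
From mathcomp Require Import all_classical all_reals all_analysis.
Set Implicit Arguments.
Unset Strict Implicit.
Unset Printing Implicit Defensive.
Import Order.TTheory GRing.Theory Num.Theory.
Import numFieldNormedType.Exports.
Local Open Scope classical_set_scope.
Local Open Scope ring_scope.

Record sgraph := SGraph {
  vertex :> finType;
  adj : rel vertex;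
  adj_sym : symmetric adj;
  adj_irrefl : irreflexive adj
}.

(* An edge is the (unordered) set of its two endpoints. *)
Definition is_edge (G : sgraph) (e : {set G}) : Prop :=
  exists x y : G, adj x y /\ e = [set x; y]%SET.

Definition adjacent_edges (G : sgraph) (e f : {set G}) : Prop :=
  e <> f /\ exists v : G, v \in e /\ v \in f.

Definition segment (R : realType) (a b : R * R) : set (R * R) :=
  [set ((1 - t) * a.1 + t * b.1, (1 - t) * a.2 + t * b.2) | t in `[0, 1]].

Definition dot (R : realType) (u v : R * R) : R := u.1 * v.1 + u.2 * v.2.

(* A is a Jordan arc (homeomorphic image of [0, 1]) with endpoints a and b. *)
Definition jordan_arc (R : realType) (a b : R * R) (A : set (R * R)) : Prop :=
  exists g : R -> R * R,
    [/\ {within `[0, 1], continuous g}, set_inj `[0, 1] g,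
        g 0 = a, g 1 = b & g @` `[0, 1] = A].

(* Arcs are represented by their point sets.  The value of [edge_arc] on sets that
   are not edges is irrelevant. *)
Record predrawing (R : realType) (G : sgraph) := PreDrawing {
  pos : G -> R * R;
  edge_arc : {set G} -> set (R * R)
}.

Definition crossing_points (R : realType) (G : sgraph) (D : predrawing R G)
    (e f : {set G}) : set (R * R) :=
  (edge_arc D e `\` pos D @` [set` e]) `&` (edge_arc D f `\` pos D @` [set` f]).

(* Every common interior point counts as a crossing.  No separate condition on
   points shared by three edges is imposed: in a drawing as below, such points
   are ruled out both by [right_angle_crossings] for straight edges (three
   lines in the plane are not pairwise orthogonal) and by [fan_crossings] (two
   edges through the point would be adjacent and cross). *)
Definition crosses (R : realType) (G : sgraph) (D : predrawing R G)
    (e f : {set G}) : Prop :=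
  e <> f /\ crossing_points D e f !=set0.

Record is_drawing (R : realType) (G : sgraph) (D : predrawing R G) : Prop :=
  IsDrawing {
    pos_inj : injective (pos D);
    arc_jordan : forall x y : G, adj x y ->
      jordan_arc (pos D x) (pos D y) (edge_arc D [set x; y]%SET);
    arc_vertex : forall (e : {set G}) (v : G), is_edge e ->
      edge_arc D e (pos D v) -> v \in e
  }.

Record is_simple (R : realType) (G : sgraph) (D : predrawing R G) : Prop :=
  IsSimple {
    adjacent_not_cross : forall e f : {set G}, is_edge e -> is_edge f ->
      adjacent_edges e f -> ~ crosses D e f;
    cross_at_most_once : forall e f : {set G}, is_edge e -> is_edge f ->
      e <> f -> is_subset1 (crossing_points D e f)
  }.

Definition straight_line (R : realType) (G : sgraph) (D : predrawing R G) :
    Prop :=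
  forall x y : G, adj x y -> edge_arc D [set x; y]%SET = segment (pos D x) (pos D y).

Definition right_angle_crossings (R : realType) (G : sgraph)
    (D : predrawing R G) : Prop :=
  forall x y z w : G, adj x y -> adj z w ->
    crosses D [set x; y]%SET [set z; w]%SET ->
    dot (pos D y - pos D x) (pos D w - pos D z) = 0.

(* A single vertex must be common to all the edges crossing e; pairwise
   adjacency of these edges would not be enough (they could form a triangle). *)
Definition fan_crossings (R : realType) (G : sgraph) (D : predrawing R G) :
    Prop :=
  forall e : {set G}, is_edge e ->
    exists v : G, forall f : {set G}, is_edge f -> crosses D e f -> v \in f.

Definition RAC (R : realType) (G : sgraph) : Prop :=
  exists D : predrawing R G,
    [/\ is_drawing D, is_simple D, straight_line D & right_angle_crossings D].

Definition fan_crossing (R : realType) (G : sgraph) : Prop :=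
  exists D : predrawing R G,
    [/\ is_drawing D, is_simple D & fan_crossings D].

(* Main.v *)
(* Let G be the complete graph K_n, n > 500, with every edge subdivided into a
   path of five edges.  Placing the hubs (the vertices of K_n) on a vertical line
   and routing each path as a spoke, a horizontal, a vertical, a horizontal and a
   spoke segment, only horizontal and vertical segments cross, so G is RAC.

   In a fan-crossing drawing, each of the five edges of the path of {a, b} is
   crossed only by edges at one vertex, which is owned by some hub.  Counting,
   there are five hubs such that no path joining two of them meets an edge at a
   vertex owned by one of the other three.  Disjoint edges of the K_5 on these
   hubs then have disjoint paths.

   This is impossible.  Approximate the paths by polylines, and let N(ab, c) be
   the parity of the number of hits of the polyline ab by the upward ray from c.
   For disjoint polylines ab and cd, N(ab, c) + N(ab, d) + N(cd, a) + N(cd, b) is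
   odd exactly when the abscissae of {a, b} and {c, d} interleave: both sides are
   additive in the polylines, so this is a statement on two segments.  Summing
   over the fifteen pairs of disjoint edges of K_5, every N(ab, c) occurs twice,
   while each of the five 4-subsets has exactly one interleaving pairing. *)
Require Import Defs.
From mathcomp Require Import all_boot all_order all_algebra.
From mathcomp Require Import all_classical all_reals all_analysis.
From mathcomp Require Import ring lra zify.
From Stdlib Require Import Btauto.
Set Implicit Arguments.
Unset Strict Implicit.
Unset Printing Implicit Defensive.
Import Order.TTheory GRing.Theory Num.Theory.
Import numFieldNormedType.Exports.
Local Open Scope classical_set_scope.
Local Open Scope ring_scope.

Lemma disj_neq (T : Type) (A B : set T) x y :
  A `&` B = set0 -> A x -> B y -> x <> y.
Proof.
by move=> AB Ax By xy; have : (A `&` B) x; [split; rewrite // xy|rewrite AB].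
Qed.

(** * Ray hits for two disjoint segments *)

Section SegmentParity.
Variable R : realType.
Implicit Types a b c d p q v : R * R.

(** The order of abscissae after an infinitesimal shear. It compares any two distinct points, so no
    general position has to be assumed. *)
Definition lex a b := (a.1 < b.1) || (a.1 == b.1) && (a.2 < b.2).

Lemma lex_total a b : a <> b -> lex b a = ~~ lex a b.
Proof.
case: a b => [x y] [z w] ne; rewrite /lex /=.
case: (ltgtP x z) => //= exz; case: (ltgtP y w) => //= eyw.
by case: ne; rewrite exz eyw.
Qed.

(** A small positive [m] turns the order into an inequality between reals; finitely many comparisons
    can share one [m], after which real arithmetic applies. *)
Lemma lex_shear a b : lex a b ->
  \forall m \near 0^'+, a.1 + m * a.2 < b.1 + m * b.2.
Proof.
case/orP => [ab|/andP[/eqP-> ab]]; last first.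
  by near=> m; rewrite ltrD2l ltr_pM2l.
pose k := `|a.2 - b.2| + 1.
have k0 : 0 < k by rewrite ltr_wpDl.
near=> m.
have m0 : 0 < m by [].
have mk : m < (b.1 - a.1) / k.
  by near: m; apply: nbhs_right_lt; rewrite divr_gt0// subr_gt0.
rewrite ltr_pdivlMr// in mk.
have : m * (a.2 - b.2) <= m * k.
  by rewrite ler_pM2l// (le_trans (ler_norm _))// lerDl.
lra.
Unshelve. all: by end_near. Qed.

(** Twice the signed area of the triangle: negative when [c] is to the right of the line from [a] to
    [b], hence below that line when [lex a b]. *)
Definition orient a b c :=
  (b.1 - a.1) * (c.2 - a.2) - (b.2 - a.2) * (c.1 - a.1).

(* The upward ray from [c], tilted infinitesimally to break ties, meets the
   segment [a, b]. *)
Definition ray_hit a b c :=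
  xorb (lex a c) (lex b c) &&
  (if lex a b then orient a b c < 0 else 0 < orient a b c).

Lemma ray_hitC a b c : ray_hit a b c = ray_hit b a c.
Proof.
have [->//|ne] := pselect (a = b).
rewrite /ray_hit (lex_total ne) Bool.xorb_comm if_neg.
have -> : orient b a c = - orient a b c by rewrite /orient; ring.
by rewrite oppr_lt0 oppr_gt0.
Qed.

Lemma segmentC a b : segment a b = segment b a.
Proof.
suff sub c d : segment c d `<=` segment d c by apply/seteqP; split; exact: sub.
move=> p [t /= /andP[]]; rewrite !bnd_simp => t0 t1 <-; exists (1 - t) => /=.
  by rewrite in_itv/= subr_ge0 t1 gerBl.
by congr pair; ring.
Qed.

Lemma segmentP a b p (t : R) : 0 <= t <= 1 ->
  p.1 = (1 - t) * a.1 + t * b.1 -> p.2 = (1 - t) * a.2 + t * b.2 ->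
  segment a b p.
Proof. by case: p => x y t01 /= -> ->; exists t. Qed.

(** The weights are not normalised, so that orientations can serve directly as weights. *)
Lemma barycenter_segment a b p (u v : R) : 0 <= u -> 0 <= v -> 0 < u + v ->
  u * a.1 + v * b.1 = (u + v) * p.1 -> u * a.2 + v * b.2 = (u + v) * p.2 ->
  segment a b p.
Proof.
move=> u0 v0 uv0 e1 e2; have uvN0 : u + v != 0 by rewrite gt_eqF.
apply: (@segmentP _ _ _ (v / (u + v))).
- by apply/andP; split; [rewrite divr_ge0// ltW|rewrite ler_pdivrMr// mul1r lerDr].
- by apply: (mulfI uvN0); rewrite -e1; field.
- by apply: (mulfI uvN0); rewrite -e2; field.
Qed.

Lemma barycenter_meet a b c d (u v w z : R) :
  0 <= u -> 0 <= v -> 0 <= w -> 0 <= z -> 0 < u + v -> u + v = w + z ->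
  u * a.1 + v * b.1 = w * c.1 + z * d.1 ->
  u * a.2 + v * b.2 = w * c.2 + z * d.2 ->
  segment a b `&` segment c d !=set0.
Proof.
move=> u0 v0 w0 z0 uv0 uvwz e1 e2; have uvN0 : u + v != 0 by rewrite gt_eqF.
exists ((u * a.1 + v * b.1) / (u + v), (u * a.2 + v * b.2) / (u + v)).
split; [apply: (@barycenter_segment _ _ _ u v)|
        apply: (@barycenter_segment _ _ _ w z)] => //=; rewrite -?uvwz//.
all: by rewrite ?e1 ?e2; field.
Qed.

Lemma lex_shear3 a b c d : lex a b -> lex b c -> lex c d ->
  exists m, [/\ a.1 + m * a.2 < b.1 + m * b.2, b.1 + m * b.2 < c.1 + m * c.2 &
    c.1 + m * c.2 < d.1 + m * d.2].
Proof.
move=> /lex_shear ab /lex_shear bc /lex_shear cd.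
by near (0 : R)^'+ => m; exists m; split; near: m.
Unshelve. all: by end_near. Qed.

(** The weights are differences of sheared abscissae, since differences of plain abscissae vanish on
    a vertical segment. *)
Lemma lex_collinear_segment a b c : lex a c -> lex c b -> orient a b c = 0 ->
  segment a b c.
Proof.
move=> ac cb k0.
have [m [xac xcb]] : exists m, a.1 + m * a.2 < c.1 + m * c.2 /\
    c.1 + m * c.2 < b.1 + m * b.2.
  have [m xac xcb] : exists2 m, a.1 + m * a.2 < c.1 + m * c.2 &
    c.1 + m * c.2 < b.1 + m * b.2.
    have := lex_shear ac; have := lex_shear cb => h1 h2.
    by near (0 : R)^'+ => m; exists m; near: m.
  by exists m.
apply: (@barycenter_segment _ _ _ (b.1 + m * b.2 - (c.1 + m * c.2))
   (c.1 + m * c.2 - (a.1 + m * a.2))); rewrite ?subr_ge0 ?ltW//; first lra.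
  have -> : (b.1 + m * b.2 - (c.1 + m * c.2)) * a.1 +
      (c.1 + m * c.2 - (a.1 + m * a.2)) * b.1 =
     (b.1 + m * b.2 - (c.1 + m * c.2) + (c.1 + m * c.2 - (a.1 + m * a.2))) * c.1
     + m * orient a b c by rewrite /orient; ring.
  by rewrite k0; ring.
have -> : (b.1 + m * b.2 - (c.1 + m * c.2)) * a.2 +
      (c.1 + m * c.2 - (a.1 + m * a.2)) * b.2 =
     (b.1 + m * b.2 - (c.1 + m * c.2) + (c.1 + m * c.2 - (a.1 + m * a.2))) * c.2
     - orient a b c by rewrite /orient; ring.
by rewrite k0; ring.
Unshelve. all: by end_near. Qed.

(* The affine dependence of four points gives the weights with which two segments
   are shown to meet. *)
Lemma orient_dep a b c d :
  [/\ - orient b c d + orient a c d = orient a b d - orient a b c,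
   - orient b c d * a.1 + orient a c d * b.1 =
     orient a b d * c.1 - orient a b c * d.1 &
   - orient b c d * a.2 + orient a c d * b.2 =
     orient a b d * c.2 - orient a b c * d.2].
Proof. by rewrite /orient; split; ring. Qed.

(** Sheared abscissae come in the order [a], [c], [b], [d]; together with the balance of weights
    this forces [v] and [w] to be nonnegative as well. *)
Lemma interleaved_meet_aux a b c d (u v w z : R) :
  lex a c -> lex c b -> lex b d -> 0 <= u -> 0 < z -> u + v = w + z ->
  u * a.1 + v * b.1 = w * c.1 + z * d.1 ->
  u * a.2 + v * b.2 = w * c.2 + z * d.2 ->
  segment a b `&` segment c d !=set0.
Proof.
move=> ac cb bd u0 z0 uvwz e1 e2.
have [m [hac hcb hbd]] := lex_shear3 ac cb bd.
have e : u * (a.1 + m * a.2) + v * (b.1 + m * b.2) =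
         w * (c.1 + m * c.2) + z * (d.1 + m * d.2).
  transitivity (u * a.1 + v * b.1 + m * (u * a.2 + v * b.2)); first ring.
  by rewrite e1 e2; ring.
move: (a.1 + m * a.2) (b.1 + m * b.2) (c.1 + m * c.2) (d.1 + m * d.2)
  hac hcb hbd e => xa xb xc xd hac hcb hbd e.
have v0 : 0 <= v.
  rewrite leNgt; apply/negP => v0.
  have [w0|w0] := leP 0 w; nra.
have w0 : 0 <= w by rewrite leNgt; apply/negP => w0; nra.
by apply: (@barycenter_meet _ _ _ _ u v w z) => //; lra.
Qed.

Lemma nested_meet_aux a b c d (u v w z : R) :
  lex a c -> lex c d -> lex d b -> 0 <= w -> 0 <= z -> 0 < w + z ->
  u + v = w + z ->
  u * a.1 + v * b.1 = w * c.1 + z * d.1 ->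
  u * a.2 + v * b.2 = w * c.2 + z * d.2 ->
  segment a b `&` segment c d !=set0.
Proof.
move=> ac cd db w0 z0 wz0 uvwz e1 e2.
have [m [hac hcd hdb]] := lex_shear3 ac cd db.
have e : u * (a.1 + m * a.2) + v * (b.1 + m * b.2) =
         w * (c.1 + m * c.2) + z * (d.1 + m * d.2).
  transitivity (u * a.1 + v * b.1 + m * (u * a.2 + v * b.2)); first ring.
  by rewrite e1 e2; ring.
move: (a.1 + m * a.2) (b.1 + m * b.2) (c.1 + m * c.2) (d.1 + m * d.2)
  hac hcd hdb e => xa xb xc xd hac hcd hdb e.
have v0 : 0 <= v by rewrite leNgt; apply/negP => v0; nra.
have u0 : 0 <= u by rewrite leNgt; apply/negP => u0; nra.
by apply: (@barycenter_meet _ _ _ _ u v w z) => //; lra.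
Qed.

(** Over their common range of abscissae one of the disjoint segments stays above the other, and the
    ends [c] and [b] of this range test this in opposite ways. Otherwise [c] lies on the first
    segment, or the weights of [orient_dep] have signs that yield a common point. *)
Lemma interleaved_ray_hit a b c d : lex a c -> lex c b -> lex b d ->
  segment a b `&` segment c d = set0 ->
  xorb (orient a b c < 0) (orient c d b < 0).
Proof.
move=> ac cb bd dis; apply: contrapT => /negP same.
have meet : segment a b `&` segment c d !=set0; last first.
  by move: meet; rewrite dis => -[].
have [oE1 oE2 oE3] := orient_dep a b c d.
have cdb : orient c d b = orient b c d by rewrite /orient; ring.
rewrite cdb in same.
have [k0|k0|k0] := ltgtP (orient a b c) 0.
- move: same; rewrite k0; case: (ltP (orient b c d) 0) => //= k1 _.
  by apply: (interleaved_meet_aux ac cb bd _ _ oE1); rewrite ?mulNr ?oE2 ?oE3//; lra.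
- move: same; rewrite (ltNge (orient a b c)) (ltW k0).
  case: (ltP (orient b c d) 0) => //= k1 _.
  apply: (@interleaved_meet_aux _ _ _ _ (orient b c d) (- orient a c d)
    (- orient a b d) (orient a b c) ac cb bd) => //.
  + by move: oE1; lra.
  + by move: oE2; lra.
  + by move: oE3; lra.
- exists c; split; first exact: lex_collinear_segment.
  by apply: (@segmentP _ _ _ 0); rewrite ?lexx ?ler01//; ring.
Qed.

(** If [c] and [d] were on different sides, [orient_dep] would give them weights of the same sign,
    and the segments would meet. *)
Lemma nested_ray_hit a b c d : lex a c -> lex c d -> lex d b ->
  segment a b `&` segment c d = set0 ->
  (orient a b c < 0) = (orient a b d < 0).
Proof.
move=> ac cd db dis; apply: contrapT => /eqP same.
have meet : segment a b `&` segment c d !=set0; last first.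
  by move: meet; rewrite dis => -[].
have [oE1 oE2 oE3] := orient_dep a b c d.
move: same; case: (ltP (orient a b c) 0) => k0; case: (ltP (orient a b d) 0) => //= k1 _.
  apply: (@nested_meet_aux _ _ _ _ (- orient b c d) (orient a c d)
    (orient a b d) (- orient a b c) ac cd db); lra.
apply: (@nested_meet_aux _ _ _ _ (orient b c d) (- orient a c d)
    (- orient a b d) (orient a b c) ac cd db); lra.
Qed.

(* For disjoint arcs [P] from [a] to [b] and [Q] from [c] to [d], closing both up
   by vertical rays to infinity gives two closed curves, which cross an even
   number of times once the crossing at infinity, present when the abscissae of
   the end points interleave, is counted. *)
Definition ray_parity (hP hQ : R * R -> bool) a b c d :=
  xorb (xorb (hP c) (hP d)) (xorb (hQ a) (hQ b)) =
  xorb (xorb (lex a c) (lex b c)) (xorb (lex a d) (lex b d)).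

Lemma ray_parityC1 a b c d : ray_parity (ray_hit a b) (ray_hit c d) a b c d ->
  ray_parity (ray_hit b a) (ray_hit c d) b a c d.
Proof.
by rewrite /ray_parity !(ray_hitC b a) (Bool.xorb_comm (ray_hit c d b)) => ->;
  rewrite (Bool.xorb_comm (lex b c)) (Bool.xorb_comm (lex b d)).
Qed.

(** Exchanging the arcs negates all four comparisons of distinct ends, which does not change their
    parity. *)
Lemma ray_parityS (hP hQ : R * R -> bool) a b c d :
  a <> c -> a <> d -> b <> c -> b <> d ->
  ray_parity hP hQ a b c d -> ray_parity hQ hP c d a b.
Proof.
move=> ac ad bc bd; rewrite /ray_parity (lex_total ac) (lex_total ad).
rewrite (lex_total bc) (lex_total bd).
by case: (hP c) (hP d) (hQ a) (hQ b) (lex a c) (lex b c) (lex a d) (lex b d)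
  => [] [] [] [] [] [] [] [].
Qed.

Lemma segment_l a b : segment a b a.
Proof. by apply: (@segmentP _ _ _ 0); rewrite ?lexx ?ler01//; ring. Qed.

Lemma segment_r a b : segment a b b.
Proof. by rewrite segmentC; exact: segment_l. Qed.

(** By symmetry [a] precedes [b] and [c], and [c] precedes [d]. There remain the separated case,
    without hits, the interleaved one and the nested one. *)
Lemma segment_ray_parity a b c d : segment a b `&` segment c d = set0 ->
  ray_parity (ray_hit a b) (ray_hit c d) a b c d.
Proof.
have lex_trans : forall x y z, lex x y -> lex y z -> lex x z.
  move=> x y z /orP[xy|/andP[/eqP xy xy']] /orP[yz|/andP[/eqP yz yz']]; rewrite /lex.
  - by rewrite (lt_trans xy yz).
  - by rewrite -yz xy.
  - by rewrite xy yz.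
  - by rewrite xy yz eqxx (lt_trans xy' yz') orbT.
have refl a' b' c' : a' = b' -> ray_hit a' b' c' = false.
  by move=> ->; rewrite /ray_hit Bool.xorb_nilpotent.
wlog ab : a b / lex a b => [wl dis|].
  have [eab|ne] := pselect (a = b).
    by rewrite /ray_parity eab !(refl b b)// !Bool.xorb_nilpotent.
  have [ab|] := boolP (lex a b); first exact: wl.
  rewrite -lex_total// => ba; apply: ray_parityC1; apply: wl => //.
  by rewrite segmentC.
wlog cd : c d / lex c d => [wl dis|].
  have [ecd|ne] := pselect (c = d).
    by rewrite /ray_parity ecd !(refl d d)// !Bool.xorb_nilpotent.
  have [cd|] := boolP (lex c d); first exact: wl.
  rewrite -lex_total// => dc; have := wl d c dc.
  rewrite (segmentC d c) /ray_parity !(ray_hitC d c) => /(_ dis).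
  rewrite (Bool.xorb_comm (ray_hit a b d)) => ->.
  by rewrite Bool.xorb_comm.
wlog ac : a b c d ab cd / lex a c => [wl dis|].
  have nac : a <> c by apply: disj_neq dis _ _; exact: segment_l.
  have [ac|] := boolP (lex a c); first exact: wl.
  rewrite -lex_total// => ca; apply: ray_parityS; rewrite 1?eq_sym.
  - by move/esym; apply: disj_neq dis _ _; exact: segment_l.
  - by move/esym; apply: disj_neq dis _ _; [exact: segment_r|exact: segment_l].
  - by move/esym; apply: disj_neq dis _ _; [exact: segment_l|exact: segment_r].
  - by move/esym; apply: disj_neq dis _ _; exact: segment_r.
  - by apply: wl => //; rewrite setIC.
move=> dis.
have nbc : b <> c by apply: disj_neq dis _ _; [exact: segment_r|exact: segment_l].
have nbd : b <> d by apply: disj_neq dis _ _; exact: segment_r.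
have nac : a <> c by apply: disj_neq dis _ _; exact: segment_l.
have nad : a <> d by apply: disj_neq dis _ _; [exact: segment_l|exact: segment_r].
have ad := lex_trans _ _ _ ac cd.
rewrite /ray_parity /ray_hit ab cd !(lex_total nac) !(lex_total nad).
rewrite !(lex_total nbc) !(lex_total nbd) ac ad /=.
have [bc|/negbTE nlbc] := boolP (lex b c); rewrite /=.
  by rewrite (lex_trans _ _ _ bc cd).
have cb : lex c b by rewrite (lex_total nbc) nlbc.
have [bd|/negbTE nlbd] := boolP (lex b d); rewrite /=.
  by have := interleaved_ray_hit ac cb bd dis; do 2 case: (_ < _).
have db : lex d b by rewrite (lex_total nbd) nlbd.
by rewrite (nested_ray_hit ac cd db dis); case: (_ < _).
Qed.

End SegmentParity.

(** * Parity for polylines and the nonplanarity of K5 *)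

Section Polylines.
Variable R : realType.
Implicit Types (a b c d p q v : R * R) (s t : seq (R * R)).

Fixpoint polyline a s : set (R * R) :=
  if s is b :: s' then segment a b `|` polyline b s' else [set a].

Fixpoint polyline_hit a s v : bool :=
  if s is b :: s' then xorb (ray_hit a b v) (polyline_hit b s' v) else false.

Lemma polyline_head a s : polyline a s a.
Proof. by case: s => [|b s] //=; left; exact: segment_l. Qed.

Lemma polyline_last a s : polyline a s (last a s).
Proof. by elim: s a => [|b s IH] a //=; right. Qed.

Lemma ray_parity_nil hQ a c d : ray_parity (fun=> false) hQ a a c d.
Proof. by rewrite /ray_parity !Bool.xorb_nilpotent. Qed.

(** The terms at the joint [m] occur twice and cancel. *)
Lemma ray_parity_cat h1 h2 hQ a m b c d :
  ray_parity h1 hQ a m c d -> ray_parity h2 hQ m b c d ->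
  ray_parity (fun v => xorb (h1 v) (h2 v)) hQ a b c d.
Proof.
rewrite /ray_parity => e1 e2; have e := f_equal2 xorb e1 e2.
transitivity (xorb (xorb (xorb (h1 c) (h1 d)) (xorb (hQ a) (hQ m)))
  (xorb (xorb (h2 c) (h2 d)) (xorb (hQ m) (hQ b)))); first by btauto.
by rewrite e; btauto.
Qed.

Lemma polyline_segment_parity a s c d : polyline a s `&` segment c d = set0 ->
  ray_parity (polyline_hit a s) (ray_hit c d) a (last a s) c d.
Proof.
elim: s a => [|b s IH] a /=; first by move=> _; exact: ray_parity_nil.
rewrite setIUl setU_eq0 => -[d1 d2].
exact: ray_parity_cat (segment_ray_parity d1) (IH _ d2).
Qed.

Lemma polyline_parity a s c t : polyline a s `&` polyline c t = set0 ->
  ray_parity (polyline_hit a s) (polyline_hit c t) a (last a s) c (last c t).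
Proof.
move=> dis.
have ne x y : polyline a s x -> polyline c t y -> x <> y by exact: disj_neq.
elim: t c dis ne => [|b t IH] c /= dis ne.
  by rewrite /ray_parity !Bool.xorb_nilpotent.
move: dis; rewrite setIUr setU_eq0 => -[d1 d2].
have ne1 x y : polyline a s x -> segment c b y -> x <> y.
  by move=> ? ?; apply: ne => //; left.
have ne2 x y : polyline a s x -> polyline b t y -> x <> y.
  by move=> ? ?; apply: ne => //; right.
have ne1' x y : segment c b y -> polyline a s x -> y <> x.
  by move=> cy ax /esym; exact: ne1.
have ne2' x y : polyline b t y -> polyline a s x -> y <> x.
  by move=> cy ax /esym; exact: ne2.
have ha := polyline_head a s; have hl := polyline_last a s.
have hb := polyline_head b t; have hbl := polyline_last b t.
have sl := segment_l c b; have sr := segment_r c b.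
apply: ray_parityS; [by auto..|].
have := ray_parityS (ne1 _ _ ha sl) (ne1 _ _ ha sr) (ne1 _ _ hl sl)
  (ne1 _ _ hl sr) (polyline_segment_parity d1).
move=> /ray_parity_cat; apply.
by apply: ray_parityS; auto.
Qed.

(* The parities of the fifteen pairs of disjoint edges of K5 add up to a
   contradiction: each ray hit occurs twice, and of the three pairings of four
   points exactly one interleaves. *)
Lemma K5_polylines_meet (p : nat -> R * R) (L : nat -> nat -> seq (R * R)) :
  (forall i j, (i < j < 5)%N -> p i <> p j) ->
  (forall i j, (i < j < 5)%N -> last (p i) (L i j) = p j) ->
  (forall i j k l, (i < j < 5)%N -> (k < l < 5)%N ->
    [&& i != k, i != l, j != k & j != l] ->
    polyline (p i) (L i j) `&` polyline (p k) (L k l) = set0) -> False.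
Proof.
move=> ne lastL dis.
have par i j k l (ij : (i < j < 5)%N) (kl : (k < l < 5)%N)
    (ijkl : [&& i != k, i != l, j != k & j != l]) :
    ray_parity (polyline_hit (p i) (L i j)) (polyline_hit (p k) (L k l))
      (p i) (p j) (p k) (p l).
  by have := polyline_parity (dis _ _ _ _ ij kl ijkl); rewrite !lastL.
have e0 := par 0 1 2 3 isT isT isT.
have e1 := par 0 2 1 3 isT isT isT.
have e2 := par 0 3 1 2 isT isT isT.
have e3 := par 0 1 2 4 isT isT isT.
have e4 := par 0 2 1 4 isT isT isT.
have e5 := par 0 4 1 2 isT isT isT.
have e6 := par 0 1 3 4 isT isT isT.
have e7 := par 0 3 1 4 isT isT isT.
have e8 := par 0 4 1 3 isT isT isT.
have e9 := par 0 2 3 4 isT isT isT.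
have e10 := par 0 3 2 4 isT isT isT.
have e11 := par 0 4 2 3 isT isT isT.
have e12 := par 1 2 3 4 isT isT isT.
have e13 := par 1 3 2 4 isT isT isT.
have e14 := par 1 4 2 3 isT isT isT.
rewrite /ray_parity in e0 e1 e2 e3 e4 e5 e6 e7 e8 e9 e10 e11 e12 e13 e14.
have s1 := f_equal2 xorb (f_equal2 xorb e0 e1) (f_equal2 xorb e2 e3).
have s2 := f_equal2 xorb (f_equal2 xorb e4 e5) (f_equal2 xorb e6 e7).
have s3 := f_equal2 xorb (f_equal2 xorb e8 e9) (f_equal2 xorb e10 e11).
have s4 := f_equal2 xorb (f_equal2 xorb e12 e13) e14.
have := f_equal2 xorb (f_equal2 xorb s1 s2) (f_equal2 xorb s3 s4).
(* Once every comparison is written with increasing indices, both sides are Boolean polynomials that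
   reduce to constants. *)
rewrite (lex_total (ne 1 2 isT)) (lex_total (ne 1 3 isT)).
rewrite (lex_total (ne 2 3 isT)) ?(lex_total (ne 1 4 isT)).
rewrite ?(lex_total (ne 2 4 isT)) ?(lex_total (ne 3 4 isT)).
set lhs := LHS; set rhs := RHS.
have -> : lhs = false by rewrite /lhs; btauto.
have -> // : rhs = true by rewrite /rhs; btauto.
Qed.

End Polylines.

(** * Polyline approximation of compact connected sets *)

Section Paths.
Variable R : realType.
Implicit Types (a b p q x y z : R * R) (A B : set (R * R)).

Lemma segment_ball a b p (e : R) : ball a e b -> segment a b p -> ball a e p.
Proof.
move=> [ab1 ab2] [t /=]; rewrite in_itv/= => /andP[t0 t1] <-.
have conv (u w : R) : ball u e w -> ball u e ((1 - t) * u + t * w).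
  rewrite /ball/= => uw; apply: le_lt_trans uw.
  have -> : u - ((1 - t) * u + t * w) = t * (u - w) by ring.
  by rewrite normrM ger0_norm// ler_piMl.
by split; exact: conv.
Qed.

(** The points of [A] from which [b] can be reached form a nonempty subset, relatively open and
    closed because any point of [A] closer than [e] to it can be prepended to a polyline. *)
Lemma connected_polyline A a b (e : R) : connected A -> A a -> A b -> 0 < e ->
  exists2 s, last a s = b &
    polyline a s `<=` [set p | exists2 q, A q & ball q e p].
Proof.
move=> cA Aa Ab e0.
pose near_path x s := polyline x s `<=` [set p | exists2 q, A q & ball q e p].
pose B := [set x | A x /\ exists2 s, last x s = b & near_path x s].
have step x y : B x -> A y -> ball y e x -> B y.
  move=> [Ax [s sb xs]] Ay yx; split => //; exists (x :: s) => //= p [yxp|]; last exact: xs.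
  by exists y => //; exact: segment_ball yxp.
suff : B = A by move=> BA; have [] : B a by rewrite BA.
have open_nbhd (C : set (R * R)) :
    open (\bigcup_(x in C) (ball x e)^°) by apply: bigcup_open => x _; exact: open_interior.
have in_ball x : (ball x e)^° x by exact: nbhsx_ballx.
apply: cA.
- exists b; split => //; exists [::] => //= p ->; exists b => //; exact: ballxx.
- exists (\bigcup_(x in B) (ball x e)^°) => //.
  apply/seteqP; split => [x Bx|x [Ax [y By /interior_subset yx]]].
    by split; [exact: Bx.1|exists x].
  exact: step By Ax (ball_sym yx).
- exists (~` \bigcup_(x in A `\` B) (ball x e)^°); first exact: open_closedC.
  apply/seteqP; split => [x Bx|x [Ax nx]].
    split; first exact: Bx.1.
    by move=> [y [Ay nBy] /interior_subset yx]; apply: nBy; exact: step Bx Ay yx.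
  by apply: contrapT => nBx; apply: nx; exists x.
Qed.

(** Around a point of [A], a ball of radius [d] misses the closed set [B]; half of [d] works
    uniformly near that point, and compactness of [A] does the rest. *)
Lemma compact_separated A B : compact A -> compact B -> A `&` B = set0 ->
  \forall e \near 0^'+, forall x y, A x -> B y -> ~ ball x e y.
Proof.
move=> /compact_near_coveringP cA cB AB.
have clB : closed B by apply: compact_closed cB; exact: norm_hausdorff.
have /(cA _ _ (fun e x => forall y, B y -> ~ ball x e y) _) : forall x, A x ->
    \forall x' \near x & e \near (0 : R)^'+, forall y, B y -> ~ ball x' e y.
  move=> x Ax; have nBx : (~` B) x by move=> Bx; have : (A `&` B) x by []; rewrite AB.
  have /nbhs_ballP[d /= d0 xd] : nbhs x (~` B).
    by apply: open_nbhs_nbhs; split; [exact: closed_openC|].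
  near=> x' e.
  have ed : e <= d / 2 by near: e; apply: nbhs_right_le; rewrite divr_gt0.
  move=> y By x'y; apply: (xd y) => //.
  apply: (@ball_split _ _ x'); first by near: x'; by apply: nbhsx_ballx; rewrite divr_gt0.
  exact: le_ball x'y.
by apply: filterS => e sub x y /sub; apply.
Unshelve. all: by end_near. Qed.

Lemma segment_jordan_arc (a b : R * R) : a <> b -> jordan_arc a b (segment a b).
Proof.
move=> ab; exists (fun t => ((1 - t) * a.1 + t * b.1, (1 - t) * a.2 + t * b.2)).
split => //.
- have affine_cont (u w : R) : continuous (fun t : R => (1 - t) * u + t * w).
    move=> t; apply: cvgD; last by apply: cvgMr_tmp; exact: cvg_id.
    by apply: cvgMr_tmp; apply: cvgB; [exact: cvg_cst|exact: cvg_id].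
  by apply: continuous_subspaceT => t; exact: cvg_pair (affine_cont _ _ t) (affine_cont _ _ t).
- move=> t u _ _ [e1 e2]; apply: contrapT => /eqP tu; apply: ab.
  have tu0 : t - u != 0 by rewrite subr_eq0.
  case: a b e1 e2 => [a1 a2] [b1 b2] /= e1 e2.
  by congr pair; apply: (mulfI tu0); lra.
- by case: a ab => a1 a2 _ /=; congr pair; ring.
- by case: b ab => b1 b2 _ /=; congr pair; ring.
Qed.

Lemma jordan_arc_compact a b A : jordan_arc a b A -> compact A.
Proof.
move=> [g [cg _ _ _ <-]]; apply: continuous_compact cg _; exact: segment_compact.
Qed.

Lemma jordan_arc_connected a b A : jordan_arc a b A -> connected A.
Proof.
move=> [g [cg _ _ _ <-]]; apply: connected_continuous_connected cg.
exact: segment_connected.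
Qed.

Lemma jordan_arc_l a b A : jordan_arc a b A -> A a.
Proof.
by move=> [g [_ _ <- _ <-]]; exists 0; rewrite //= in_itv/= lexx ler01.
Qed.

Lemma jordan_arc_r a b A : jordan_arc a b A -> A b.
Proof.
by move=> [g [_ _ _ <- <-]]; exists 1; rewrite //= in_itv/= lexx ler01.
Qed.

(** Disjoint compact sets have a positive gap [e], and polylines within [e / 2] of them stay
    disjoint. Compact connected sets replace arcs here because a union of overlapping arcs is again
    of this kind. *)
Lemma K5_paths_meet (p : nat -> R * R) (A : nat -> nat -> set (R * R)) :
  (forall i j, (i < j < 5)%N -> p i <> p j) ->
  (forall i j, (i < j < 5)%N ->
    [/\ compact (A i j), connected (A i j), A i j (p i) & A i j (p j)]) ->
  (forall i j k l, (i < j < 5)%N -> (k < l < 5)%N ->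
    [&& i != k, i != l, j != k & j != l] -> A i j `&` A k l = set0) -> False.
Proof.
move=> ne hA dis.
(* Indices range over a finite type, so that one [e] serves all pairs. *)
have sep : \forall e \near (0:R)^'+, forall i j k l : 'I_5,
    (i < j)%N -> (k < l)%N ->
    [&& i != k :> nat, i != l :> nat, j != k :> nat & j != l :> nat] ->
    forall x y, A i j x -> A k l y -> ~ ball x e y.
  apply: filter_forall => i; apply: filter_forall => j.
  apply: filter_forall => k; apply: filter_forall => l.
  have [ij|ij] := boolP (i < j)%N; last by near=> e.
  have [kl|kl] := boolP (k < l)%N; last by near=> e.
  have [ijkl|ijkl] := boolP [&& i != k :> nat, i != l :> nat, j != k :> nat
    & j != l :> nat]; last by near=> e.
  have ij5 : (i < j < 5)%N by rewrite ij/=.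
  have kl5 : (k < l < 5)%N by rewrite kl/=.
  have [cij _ _ _] := hA _ _ ij5; have [ckl _ _ _] := hA _ _ kl5.
  have := compact_separated cij ckl (dis _ _ _ _ ij5 kl5 ijkl).
  by apply: filterS => e he _ _ _.
have [e e0 sepe] : exists2 e : R, 0 < e & forall i j k l,
    (i < j < 5)%N -> (k < l < 5)%N ->
    [&& i != k, i != l, j != k & j != l] ->
    forall x y, A i j x -> A k l y -> ~ ball x e y.
  near (0:R)^'+ => e; exists e => // i j k l /andP[ij j5] /andP[kl l5].
  have he : forall i j k l : 'I_5,
    (i < j)%N -> (k < l)%N ->
    [&& i != k :> nat, i != l :> nat, j != k :> nat & j != l :> nat] ->
    forall x y, A i j x -> A k l y -> ~ ball x e y by near: e.
  exact: (he (Ordinal (ltn_trans ij j5)) (Ordinal j5)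
    (Ordinal (ltn_trans kl l5)) (Ordinal l5)).
have /choice[L LP] : forall ij : nat * nat, exists s, (ij.1 < ij.2 < 5)%N ->
    last (p ij.1) s = p ij.2 /\ polyline (p ij.1) s `<=`
      [set x | exists2 q, A ij.1 ij.2 q & ball q (e / 2) x].
  move=> [i j] /=; have [ij|ij] := boolP (i < j < 5)%N; last by exists [::].
  have [_ c Ai Aj] := hA _ _ ij.
  have [|s s1 s2] := connected_polyline c Ai Aj (_ : 0 < e / 2); last by exists s.
  by rewrite divr_gt0.
apply: (@K5_polylines_meet _ p (fun i j => L (i, j))) => //.
  by move=> i j ij; have [] := LP (i, j) ij.
move=> i j k l ij kl ijkl; rewrite -subset0 => x [].
move=> /(LP (i, j) ij).2/= [q Aq qx] /(LP (k, l) kl).2/= [r Ar rx].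
apply: (sepe _ _ _ _ ij kl ijkl _ _ Aq Ar).
exact: ball_split qx (ball_sym rx).
Unshelve. all: by end_near. Qed.

End Paths.

(** * Choice of five hubs by a union bound *)

Section Counting.
Local Open Scope nat_scope.

(** Overwriting coordinate [i0] by an arbitrary value is injective on pairs of a counted function
    and a value: the other coordinates survive, and they determine the original one. *)
Lemma card_determined_coordinate (T I : finType) (i0 : I) (h : {ffun I -> T} -> T) :
  (forall f g : {ffun I -> T}, (forall i, i != i0 -> f i = g i) -> h f = h g) ->
  #|[set f : {ffun I -> T} | f i0 == h f]%SET| * #|T| <= #|T| ^ #|I|.
Proof.
move=> hP; set S := [set f | _]%SET.
pose upd (fx : {ffun I -> T} * T) : {ffun I -> T} :=
  [ffun i => if i == i0 then fx.2 else fx.1 i].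
have inj : {in finset.setX S [set: T]%SET &, injective upd}.
  move=> [f x] [g y]; rewrite !inE/= !andbT => /eqP fS /eqP gS e.
  have fg i : i != i0 -> f i = g i.
    by move=> /negbTE ii0; have /ffunP/(_ i) := e; rewrite !ffunE ii0.
  have -> : x = y by have /ffunP/(_ i0) := e; rewrite !ffunE eqxx.
  congr pair; apply/ffunP => i; have [->|] := eqVneq i i0; last exact: fg.
  by rewrite fS gS; exact: hP.
by rewrite -card_ffun -cardsT -[X in X <= _]finset.cardsX -(card_in_imset inj) max_card.
Qed.

Lemma card_bigcup_le (T I : finType) (A : I -> {set T}) :
  #|(\bigcup_i A i)%SET| <= \sum_i #|A i|.
Proof.
apply: (big_ind2 (fun (X : {set T}) m => #|X| <= m)); rewrite ?cards0//.
by move=> X m Y k hX hY; rewrite (leq_trans (leq_card_setU _ _))// leq_add.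
Qed.

Lemma free_quintuple n (F : 'I_n -> 'I_n -> 'I_3 -> 'I_n) : 500 < n ->
  exists2 f : 'I_5 -> 'I_n, injective f &
    forall i j l k, l != i -> l != j -> F (f i) (f j) k != f l.
Proof.
move=> n500; apply: contrapT => nofree.
(* There are 5 * 5 * 5 * 4 = 500 bad events, each of proportion at most 1 / n; [None] stands for a
   collision between [f l] and [f i]. *)
pose I := ('I_5 * 'I_5 * 'I_5 * option 'I_3)%type.
pose h (t : I) (f : {ffun 'I_5 -> 'I_n}) : 'I_n :=
  let: (i, j, _, k) := t in if k is Some k' then F (f i) (f j) k' else f i.
pose apart (t : I) := let: (i, j, l, _) := t in (l != i) && (l != j).
pose bad (t : I) : {set {ffun 'I_5 -> 'I_n}} :=
  if apart t then [set f : {ffun 'I_5 -> 'I_n} | f t.1.2 == h t f]%SET else finset.set0.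
have card_bad t : #|bad t| * n <= n ^ 5.
  rewrite /bad; case: ifP => [|_]; last by rewrite cards0.
  case: t => [[[i j] l] k] /= /andP[li lj].
  have := @card_determined_coordinate 'I_n 'I_5 l (h (i, j, l, k)).
  rewrite !card_ord; apply => f g fg /=.
  by rewrite !fg// eq_sym.
have cover : [set: {ffun 'I_5 -> 'I_n}]%SET \subset (\bigcup_t bad t)%SET.
  apply/fintype.subsetP => f _; apply: contrapT => /negP fbad; apply: nofree.
  have good t : apart t -> f t.1.2 != h t f.
    move=> tapart; apply: contra fbad => ft; apply/bigcupP; exists t => //.
    by rewrite /bad tapart inE.
  exists f => [i l|i j l k li lj]; last first.
    by have := good (i, j, l, Some k); rewrite /= li lj eq_sym; apply.
  move=> fil; apply: contrapT => /eqP il.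
  by have := good (i, i, l, None); rewrite /= eq_sym il fil eqxx => /(_ isT).
have := leq_trans (subset_leq_card cover) (card_bigcup_le bad).
rewrite cardsT card_ffun !card_ord => le1.
have : n ^ 5 * n <= 500 * n ^ 5.
  apply: (@leq_trans ((\sum_t #|bad t|) * n)); first by rewrite leq_mul2r le1 orbT.
  rewrite big_distrl/=; apply: (@leq_trans (\sum_(t : I) n ^ 5)).
    by apply: leq_sum => t _; exact: card_bad.
  by rewrite sum_nat_const !card_prod card_option !card_ord.
rewrite mulnC leq_pmul2r ?expn_gt0 ?(leq_ltn_trans _ n500)//.
by rewrite leqNgt n500.
Qed.

End Counting.

(** * The subdivided complete graph *)

Section SubdividedComplete.
Variable n : nat.

Definition sub_vertex : finType := ('I_n + 'I_n * 'I_n * bool)%type.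

Definition hub (i : 'I_n) : sub_vertex := inl i.
Definition port (i j : 'I_n) : sub_vertex := inr (i, j, false).
Definition bend (i j : 'I_n) : sub_vertex := inr (i, j, true).

(** The condition [i != j] prevents a loop at [bend i i]. *)
Definition sub_arc (u v : sub_vertex) : bool :=
  match u, v with
  | inl i, inr (k, _, false) => i == k
  | inr (i, j, false), inr (k, l, true) => (i == k) && (j == l)
  | inr (i, j, true), inr (k, l, true) => [&& i != j, i == l & j == k]
  | _, _ => false
  end.

Definition sub_adj (u v : sub_vertex) := sub_arc u v || sub_arc v u.

Lemma sub_adj_sym : symmetric sub_adj.
Proof. by move=> u v; rewrite /sub_adj orbC. Qed.

Lemma sub_adj_irrefl : irreflexive sub_adj.
Proof.
rewrite /sub_adj => -[i|[[i j] []]] //=; rewrite orbb.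
by case: eqVneq => // ij; apply/negP => /andP[/eqP/ij].
Qed.

(* The complete graph on the hubs with every edge [i, j] replaced by the path
   hub i - port i j - bend i j - bend j i - port j i - hub j; the vertices
   [port i i] and [bend i i] are dangling. *)
Definition subdivided := SGraph sub_adj_sym sub_adj_irrefl.

(** Links 0, 1, 2 lead from hub [i] to the far end of the middle edge. Link 2 is common to [(i, j)]
    and [(j, i)]; for [i = j] it degenerates and is not an edge. *)
Definition link_src (i j : 'I_n) (k : 'I_3) : subdivided :=
  match val k with 0%N => hub i | 1%N => port i j | _ => bend i j end.
Definition link_tgt (i j : 'I_n) (k : 'I_3) : subdivided :=
  match val k with 0%N => port i j | 1%N => bend i j | _ => bend j i end.
Definition link (i j : 'I_n) (k : 'I_3) : {set subdivided} :=
  [set link_src i j k; link_tgt i j k]%SET.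

Lemma I3P (P : 'I_3 -> Prop) :
  P (Ordinal (isT : 0 < 3)%N) -> P (Ordinal (isT : 1 < 3)%N) ->
  P (Ordinal (isT : 2 < 3)%N) -> forall k, P k.
Proof.
by move=> P0 P1 P2 [[|[|[|m]]] lm] //;
  [move: P0|move: P1|move: P2]; congr P; exact/val_inj.
Qed.

Lemma adj_link i j k : (val k = 2%N -> i != j) -> adj (link_src i j k) (link_tgt i j k).
Proof.
rewrite /adj/= /sub_adj; elim/I3P: k => /= ij; rewrite /link_src /link_tgt/= ?eqxx//.
by rewrite ij.
Qed.

Lemma is_edge_link i j k : i != j -> is_edge (link i j k).
Proof.
by move=> ij; exists (link_src i j k), (link_tgt i j k); split => //; exact: adj_link.
Qed.

Lemma sub_arc_link (u v : subdivided) : sub_arc u v ->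
  exists i j k, [/\ val k = 2%N -> i != j, u = link_src i j k & v = link_tgt i j k].
Proof.
move: u v => [i|[[i j] []]] [k|[[k l] []]] //=.
- by move=> /eqP<-; exists i, l, (Ordinal (isT : 0 < 3)%N).
- move=> /and3P[ij /eqP<- /eqP<-].
  by exists i, j, (Ordinal (isT : 2 < 3)%N).
- by move=> /andP[/eqP<- /eqP<-]; exists i, j, (Ordinal (isT : 1 < 3)%N).
Qed.

Lemma adj_linkP (u v : subdivided) : adj u v ->
  exists i j k, (val k = 2%N -> i != j) /\ [set u; v]%SET = link i j k.
Proof.
case/orP => /sub_arc_link[i [j [k [ij -> ->]]]]; exists i, j, k; split => //.
by rewrite finset.setUC.
Qed.

(** The hub on whose side of a path the vertex lies. *)
Definition owner (v : subdivided) : 'I_n :=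
  match v with inl i => i | inr (i, _, _) => i end.

Lemma owner_link i j k v : v \in link i j k -> owner v = i \/ owner v = j.
Proof.
by rewrite !inE /link_src /link_tgt; elim/I3P: k => /= /orP[] /eqP->; auto.
Qed.

End SubdividedComplete.

(** * No fan-crossing drawing *)

Section NotFanCrossing.
Variables (R : realType) (n : nat).
Hypothesis n500 : (500 < n)%N.
Notation G := (subdivided n).

Section Drawing.
Variable D : predrawing R G.
Hypothesis drawD : is_drawing D.

(** Each half includes the middle edge, so the two halves overlap and their union is connected. *)
Definition half_path i j := edge_arc D (link i j (inord 0)) `|`
  (edge_arc D (link i j (inord 1)) `|` edge_arc D (link i j (inord 2))).

Definition long_path i j := half_path i j `|` half_path j i.

Lemma link_jordan i j k : i != j ->
  jordan_arc (pos D (link_src i j k)) (pos D (link_tgt i j k)) (edge_arc D (link i j k)).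
Proof. by move=> ij; apply: arc_jordan drawD _ _ _; exact: adj_link. Qed.

Lemma half_pathP i j : i != j ->
  [/\ compact (half_path i j), connected (half_path i j),
   half_path i j (pos D (hub i : G)) &
   half_path i j `&` half_path j i !=set0].
Proof.
move=> ij; have ji : j != i by rewrite eq_sym.
have J k := link_jordan k ij.
have val_inord k : (k < 3)%N -> val (inord k : 'I_3) = k by exact: inordK.
have t0 : link_src i j (inord 0) = hub i by rewrite /link_src val_inord.
have h0 : link_tgt i j (inord 0) = port i j by rewrite /link_tgt val_inord.
have t1 : link_src i j (inord 1) = port i j by rewrite /link_src val_inord.
have h1 : link_tgt i j (inord 1) = bend i j by rewrite /link_tgt val_inord.
have t2 : link_src i j (inord 2) = bend i j by rewrite /link_src val_inord.
have t2' : link_src j i (inord 2) = bend j i by rewrite /link_src val_inord.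
have h2 : link_tgt i j (inord 2) = bend j i by rewrite /link_tgt val_inord.
split.
- by apply: compactU; [|apply: compactU]; apply: jordan_arc_compact (J _).
- apply: connectedU; [|exact: jordan_arc_connected (J _)|apply: connectedU].
  + exists (pos D (port i j : G)); split; first by rewrite -h0; exact: jordan_arc_r (J _).
    by left; rewrite -t1; exact: jordan_arc_l (J _).
  + exists (pos D (bend i j : G)); split; first by rewrite -h1; exact: jordan_arc_r (J _).
    by rewrite -t2; exact: jordan_arc_l (J _).
  + exact: jordan_arc_connected (J _).
  + exact: jordan_arc_connected (J _).
- by left; rewrite -t0; exact: jordan_arc_l (J _).
- exists (pos D (bend j i : G)); split; right; right.
    by rewrite -h2; exact: jordan_arc_r (J _).
  by rewrite -t2'; exact: jordan_arc_l (link_jordan _ ji).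
Qed.

Lemma long_pathP i j : i != j ->
  [/\ compact (long_path i j), connected (long_path i j),
   long_path i j (pos D (hub i : G)) & long_path i j (pos D (hub j : G))].
Proof.
move=> ij; have ji : j != i by rewrite eq_sym.
have [c1 d1 h1 m1] := half_pathP ij; have [c2 d2 h2 _] := half_pathP ji.
split; [exact: compactU|exact: connectedU|by left|by right].
Qed.

Lemma half_path_link i j x : half_path i j x ->
  exists k, edge_arc D (link i j k) x.
Proof. by move=> [|[]] ?; eexists; eassumption. Qed.

(** The common point is no vertex of either edge, since a vertex on an arc is an end of its edge. *)
Lemma disjoint_edges_crosses (e f : {set G}) x : is_edge e -> is_edge f ->
  (forall v, v \in e -> v \notin f) -> edge_arc D e x -> edge_arc D f x ->
  crosses D e f.
Proof.
move=> ee ef ef0 ex fx; split.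
  move=> eqef; have [u [v [_ ev]]] := ee.
  have ue : u \in e by rewrite ev !inE eqxx.
  by have := ef0 _ ue; rewrite -eqef ue.
exists x; split; split=> // -[v /= vE vx].
  have vf : v \in f by apply: (arc_vertex drawD ef); rewrite vx.
  by have := ef0 _ vE; rewrite vf.
have ve : v \in e by apply: (arc_vertex drawD ee); rewrite vx.
by have := ef0 _ ve; rewrite vE.
Qed.

End Drawing.

Lemma subdivided_not_fan_crossing : ~ fan_crossing R G.
Proof.
move=> [D [drawD _ fanD]].
(* [w e] lies on every edge crossing [e]; on sets that are not edges its value is arbitrary. *)
have /choice[w wP] : forall e : {set G}, exists v : G, is_edge e ->
    forall f, is_edge f -> crosses D e f -> v \in f.
  move=> e; have [/fanD[v ?]|ne] := pselect (is_edge e); first by exists v.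
  by exists (hub (Ordinal n500)).
have [f f_inj fP] := free_quintuple (fun i j k => owner (w (link i j k))) n500.
have val_inord m : (m < 5)%N -> val (inord m : 'I_5) = m by exact: inordK.
have f_neq i j : (i < 5)%N -> (j < 5)%N -> i != j ->
    (inord i : 'I_5) != inord j /\ f (inord i) != f (inord j).
  move=> i5 j5 ij; have ne : (inord i : 'I_5) != inord j.
    by apply: contra ij => /eqP/(congr1 val); rewrite !val_inord// => /eqP.
  by split => //; apply: contra ne => /eqP/f_inj/eqP.
apply: (@K5_paths_meet R (fun i => pos D (hub (f (inord i)) : G))
  (fun i j => long_path D (f (inord i)) (f (inord j)))).
- move=> i j /andP[ij j5] /(pos_inj drawD) [] /f_inj/(congr1 val).
  by rewrite !val_inord ?(ltn_trans ij)// => eij; move: ij; rewrite eij ltnn.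
- move=> i j /andP[ij j5]; apply: long_pathP => //.
  by apply: (f_neq _ _ _ _ _).2 => //; [exact: ltn_trans j5|rewrite ltn_eqF].
move=> i j k l /andP[ij j5] /andP[kl l5] /and4P[ik il jk jl].
have i5 := ltn_trans ij j5; have k5 := ltn_trans kl l5.
have ij' : i != j by rewrite ltn_eqF.
have kl' : k != l by rewrite ltn_eqF.
have [oij fij] := f_neq _ _ i5 j5 ij'; have [okl fkl] := f_neq _ _ k5 l5 kl'.
have [oik fik] := f_neq _ _ i5 k5 ik; have [oil fil] := f_neq _ _ i5 l5 il.
have [ojk fjk] := f_neq _ _ j5 k5 jk; have [ojl fjl] := f_neq _ _ j5 l5 jl.
(* A common point makes the two links cross, so [w] of the first lies on the second and is owned by
   [f c] or [f d], against the choice of [f]. *)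
have key a b c d m m' x : a != b -> c != d -> a != c -> a != d -> b != c ->
   b != d -> edge_arc D (link (f a) (f b) m) x ->
   edge_arc D (link (f c) (f d) m') x -> False.
  move=> ab cd ac ad bc bd ex fx.
  have fne u v : u != v -> f u != f v by apply: contra => /eqP/f_inj/eqP.
  have e1 := is_edge_link m (fne _ _ ab); have e2 := is_edge_link m' (fne _ _ cd).
  have dis v : v \in link (f a) (f b) m -> v \notin link (f c) (f d) m'.
    move=> /owner_link va; apply/negP => /owner_link vb.
    by case: va vb => -> [] /f_inj/eqP; apply/negP.
  have := wP _ e1 _ e2 (disjoint_edges_crosses drawD e1 e2 dis ex fx).
  move=> /owner_link[] /eqP; apply/negP; by rewrite fP// eq_sym.
rewrite -subset0 => x [] [] /half_path_link[m hm] [] /half_path_link[m' hm'].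
- by apply: key hm hm'.
- by apply: key hm hm' => //; rewrite eq_sym.
- by apply: key hm hm' => //; rewrite eq_sym.
- by apply: key hm hm' => //; rewrite eq_sym.
Qed.

End NotFanCrossing.

(** * The right-angle drawing *)

Section GridDrawing.
Variables (R : realType) (n : nat).
Notation G := (subdivided n).
Implicit Types (i j k l : 'I_n) (p : R * R).

(** Two-digit numbers in base [n]: levels separate ordered pairs, columns only unordered ones, which
    makes the middle edges vertical. The successor keeps columns to the right of the ports. *)
Definition level i j : nat := (n * i + j)%N.
Definition column i j : nat := (n * minn i j + maxn i j).+1.

(** The spokes of hub [i] climb from height [n * i] to levels below [n * i + n], so they stay under
    those of the next hub. *)
Definition grid_pos (v : G) : R * R :=
  match v with
  | inl i => (-1, (n * i)%:R)
  | inr (i, j, false) => (0, (level i j)%:R)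
  | inr (i, j, true) => ((column i j)%:R, (level i j)%:R)
  end.

(** An arc is attached to an unordered edge; both orientations of the edge describe the same
    segment. *)
Definition grid_drawing : predrawing R G := PreDrawing grid_pos
  (fun e => [set p | exists u v : G,
     [/\ adj u v, e = [set u; v]%SET & segment (grid_pos u) (grid_pos v) p]]).

Notation D := grid_drawing.

Lemma base_inj (a b c d : nat) : (b < n)%N -> (d < n)%N ->
  (n * a + b = n * c + d)%N -> a = c /\ b = d.
Proof.
move=> bn dn e; have n0 : (0 < n)%N by exact: leq_ltn_trans bn.
have := congr1 (divn^~ n) e; have := congr1 (modn^~ n) e.
by rewrite /= ![(n * _)%N]mulnC !modnMDl !divnMDl// !divn_small// !modn_small// !addn0.
Qed.

Lemma level_inj i j k l : level i j = level k l -> i = k /\ j = l.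
Proof.
by move=> /base_inj[]// /val_inj -> /val_inj ->.
Qed.

Lemma columnC i j : column i j = column j i.
Proof. by rewrite /column minnC maxnC. Qed.

Lemma column_inj i j k l : column i j = column k l ->
  (i = k /\ j = l) \/ (i = l /\ j = k).
Proof.
move=> [] /base_inj[||emin emax]; rewrite ?gtn_max ?ltn_ord//.
have [[ik jl]|[il jk]] :
    (i = k :> nat /\ j = l :> nat) \/ (i = l :> nat /\ j = k :> nat) by lia.
  by left; split; exact: val_inj.
by right; split; exact: val_inj.
Qed.

Lemma column_gt0 i j : 0 < (column i j)%:R :> R.
Proof. by rewrite ltr0n. Qed.

Lemma base_natr_inj i k : (n * i)%:R = (n * k)%:R :> R -> i = k.
Proof.
move=> /eqP; rewrite eqr_nat eqn_pmul2l; last exact: leq_ltn_trans (ltn_ord i).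
by move/eqP/val_inj.
Qed.

Lemma level_natr_inj i j k l : (level i j)%:R = (level k l)%:R :> R ->
  i = k /\ j = l.
Proof. by move=> /eqP; rewrite eqr_nat => /eqP/level_inj. Qed.

Lemma column_natr_inj i j k l : (column i j)%:R = (column k l)%:R :> R ->
  (i = k /\ j = l) \/ (i = l /\ j = k).
Proof. by move=> /eqP; rewrite eqr_nat => /eqP/column_inj. Qed.

Lemma grid_pos_inj : injective grid_pos.
Proof.
have cp := column_gt0.
move=> [i|[[i j] []]] [k|[[k l] []]] e; have := congr1 fst e;
  have := congr1 snd e; rewrite /= => e2 e1 {e}.
- by rewrite (base_natr_inj e2).
- by exfalso; have := cp k l; lra.
- by exfalso; lra.
- by exfalso; have := cp i j; lra.
- by have [-> ->] := level_natr_inj e2.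
- by exfalso; have := cp i j; lra.
- by exfalso; lra.
- by exfalso; have := cp k l; lra.
- by have [-> ->] := level_natr_inj e2.
Qed.

Lemma set2_inj (T : finType) (x y z w : T) : [set x; y]%SET = [set z; w]%SET ->
  (x = z /\ y = w) \/ (x = w /\ y = z).
Proof.
move=> e; have : x \in [set z; w]%SET by rewrite -e !inE eqxx.
have : y \in [set z; w]%SET by rewrite -e !inE eqxx orbT.
have : z \in [set x; y]%SET by rewrite e !inE eqxx.
have : w \in [set x; y]%SET by rewrite e !inE eqxx orbT.
rewrite !inE => /orP[]/eqP ? /orP[]/eqP ? /orP[]/eqP ? /orP[]/eqP ?; subst; auto.
Qed.

Lemma grid_straight : straight_line D.
Proof.
move=> x y xy; apply/seteqP; split=> p /=; last by exists x, y.
by move=> [u [v [_ /set2_inj[] [-> ->] //]]]; rewrite segmentC.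
Qed.

Lemma link_segment i j (k : 'I_3) : (val k = 2%N -> i != j) ->
  edge_arc D (link i j k) = segment (grid_pos (link_src i j k)) (grid_pos (link_tgt i j k)).
Proof. by move=> ij; rewrite grid_straight//; exact: adj_link. Qed.

Lemma edge_linkP (e : {set G}) : is_edge e ->
  exists i j (k : 'I_3), (val k = 2%N -> i != j) /\ e = link i j k.
Proof. by move=> [u [v [/adj_linkP H ->]]]. Qed.

Definition on_link i j (k : 'I_3) p : Prop :=
  match val k with
  | 0%N => exists t : R, [/\ 0 <= t <= 1, p.1 = t - 1 & p.2 = (n * i)%:R + t * j%:R]
  | 1%N => 0 <= p.1 <= (column i j)%:R /\ p.2 = (level i j)%:R
  | _ => p.1 = (column i j)%:R
  end.

Lemma link_on i j (k : 'I_3) p : (val k = 2%N -> i != j) -> edge_arc D (link i j k) p ->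
  on_link i j k p.
Proof.
move=> ij; rewrite link_segment//= => -[t /=]; rewrite in_itv/= => /andP[t0 t1] <-.
move: ij; rewrite /on_link /link_src /link_tgt; elim/I3P: k => /= ij.
- by exists t; split; [rewrite t0 t1|ring|rewrite /level natrD; ring].
- have c0 := column_gt0 i j; split; last ring.
  by rewrite /= mulr0 add0r; apply/andP; split; [rewrite mulr_ge0// ltW|nra].
- by rewrite (columnC j i); ring.
Qed.

(** At parameter [t] the spokes of hub [i] have ordinates between [n * i] and [n * i + n - 1],
    ranges that are disjoint for different hubs. *)
Lemma fan_level i j k l (t : R) : 0 <= t <= 1 ->
  (n * i)%:R + t * j%:R = (n * k)%:R + t * l%:R -> i = k /\ (t = 0 \/ j = l).
Proof.
move=> t01 e.
have lt_fan (a b c d : 'I_n) : (a < c)%N ->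
    (n * a)%:R + t * b%:R < (n * c)%:R + t * d%:R.
  move=> ac; have : (n * a + b < n * c)%N by have := ltn_ord b; nia.
  rewrite -(ltr_nat R) natrD => lt1.
  have b0 := ler0n R b; have d0 := ler0n R d.
  have : t * b%:R <= b%:R by nra.
  have : 0 <= t * d%:R by nra.
  lra.
have ik : i = k.
  apply/val_inj; have [/lt_fan|/lt_fan|//] := ltngtP i k => H.
    by have := H j l; rewrite e ltxx.
  by have := H l j; rewrite e ltxx.
split => //; move: e; rewrite ik => /addrI/eqP.
rewrite -subr_eq0 -mulrBr mulf_eq0 subr_eq0 eqr_nat => /orP[/eqP|/eqP/val_inj]; auto.
Qed.

Lemma grid_drawingP : is_drawing D.
Proof.
split; first exact: grid_pos_inj.
- move=> x y xy; rewrite grid_straight//.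
  apply: segment_jordan_arc => /grid_pos_inj exy.
  by move: xy; rewrite exy adj_irrefl.
- move=> e v /edge_linkP[i [j [k [ij ->]]]] /(link_on ij).
  have cp := column_gt0.
  rewrite /on_link /link /link_src /link_tgt; elim/I3P: k ij => /= ij; rewrite !inE.
  + move=> [t [/andP[t0 t1]]]; case: v => [a|[[a b] []]] /= e1 e2.
    * have t00 : t = 0 by lra.
      by move: e2; rewrite t00 mul0r addr0 => /base_natr_inj ->; rewrite eqxx.
    * by have := cp a b; lra.
    * have t11 : t = 1 by lra.
      move: e2; rewrite t11 mul1r -natrD => /level_natr_inj[-> ->].
      by rewrite eqxx ?orbT.
  + move=> [/andP[t0 t1]]; case: v t0 t1 => [a|[[a b] []]] /= t0 t1.
    * lra.
    * by move=> /level_natr_inj[-> ->]; rewrite eqxx ?orbT.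
    * by move=> /level_natr_inj[-> ->]; rewrite eqxx.
  + case: v => [a|[[a b] []]] /= e1.
    * by have := cp i j; lra.
    * by have [[-> ->]|[-> ->]] := column_natr_inj e1; rewrite eqxx ?orbT.
    * by have := cp i j; lra.
Qed.

(** Different columns exclude the bend where the horizontal and vertical links of one path meet. The
    point depends on the links only, so edges cross at most once. *)
Definition hv_crossing i j k l p :=
  p = ((column k l)%:R, (level i j)%:R) /\ column i j <> column k l.

(** Interiors of spokes lie strictly left of abscissa 0, all other links do not; [fan_level]
    separates spokes, levels separate horizontal links and columns separate vertical ones. *)
Lemma link_crossing i j (a : 'I_3) k l (b : 'I_3) p :
  (val a = 2%N -> i != j) -> (val b = 2%N -> k != l) ->
  link i j a <> link k l b ->
  crossing_points D (link i j a) (link k l b) p ->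
  [/\ val a = 1%N, val b = 2%N & hv_crossing i j k l p] \/
  [/\ val a = 2%N, val b = 1%N & hv_crossing k l i j p].
Proof.
move=> ij kl ne [[/(link_on ij) p1 n1] [/(link_on kl) p2 n2]].
have cp := column_gt0.
have vert i' j' k' l' (c d : 'I_3) q : val c = 1%N -> val d = 2%N ->
    on_link i' j' c q -> on_link k' l' d q ->
    ~ (pos D @` [set` link i' j' c]) q -> hv_crossing i' j' k' l' q.
  rewrite /on_link => c1 d2; rewrite c1 d2 => -[_ q2] q1 nq; split.
    by case: q q1 q2 {nq} => q1 q2 /= -> ->.
  move=> e; apply: nq; exists (bend i' j' : G).
    by rewrite /= /link /link_tgt c1 !inE eqxx orbT.
  by case: q q1 q2 => q1 q2 /= -> ->; rewrite e.
have fan i' j' (c : 'I_3) q : val c = 0%N -> on_link i' j' c q ->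
    ~ (pos D @` [set` link i' j' c]) q -> -1 < q.1 < 0.
  rewrite /on_link /link /link_src /link_tgt => c0; rewrite c0.
  move=> [t [/andP[t0 t1] e1 e2]] nq; apply/andP; split.
    rewrite lt_neqAle; apply/andP; split; last lra.
    apply/eqP => q1; apply: nq; exists (hub i' : G); first by rewrite /= !inE eqxx.
    have t00 : t = 0 by lra.
    by case: q e1 e2 q1 => x y /= e1 -> <-; rewrite t00; congr pair; ring.
  rewrite lt_neqAle; apply/andP; split; last lra.
  apply/eqP => q1; apply: nq; exists (port i' j' : G); first by rewrite /= !inE eqxx orbT.
  have t11 : t = 1 by lra.
  by case: q e1 e2 q1 => x y /= e1 -> ->; rewrite t11 /level natrD; congr pair; ring.
move: p1 p2 n1 n2 (vert i j k l a b p) (vert k l i j b a p) (fan i j a p) (fan k l b p).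
rewrite {vert fan}; elim/I3P: a ij ne => ij ne; elim/I3P: b kl ne => kl ne /=;
  rewrite /on_link/= => p1 p2 n1 n2 V1 V2 F1 F2.
- exfalso; have /andP[f1 f1'] := F1 erefl p1 n1;
  move: p1 p2 => [t [t01 e1 e2]] [u [_ e3 e4]].
  have ut : u = t by apply: (addIr (-1)); rewrite -e3 -e1.
  rewrite ut e2 in e4.
  have [ik [t0|jl]] := fan_level t01 e4; last by apply: ne; rewrite ik jl.
  by move: f1; rewrite e1 t0 sub0r ltxx.
- by exfalso; move: (F1 erefl p1 n1) (p2.1); rewrite ?p1 ?p2; clear; lra.
- by exfalso; move: (F1 erefl p1 n1) (cp k l); rewrite ?p1 ?p2; clear; lra.
- by exfalso; move: (F2 erefl p2 n2) (p1.1); rewrite ?p1 ?p2; clear; lra.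
- exfalso; apply: ne.
  by have [-> ->] : i = k /\ j = l by apply: level_natr_inj; rewrite -p1.2 -p2.2.
- by left; split=> //; exact: V1.
- by exfalso; move: (F2 erefl p2 n2) (cp i j); rewrite ?p1 ?p2; clear; lra.
- by right; split=> //; exact: V2.
(* Vertical links in one column belong to the same unordered pair, hence are the same edge. *)
- exfalso; apply: ne; rewrite /link /link_src /link_tgt /=.
  have [[-> ->]|[-> ->]] // : (i = k /\ j = l) \/ (i = l /\ j = k).
    by apply: column_natr_inj; rewrite -p1 -p2.
  by rewrite finset.setUC.
Qed.

Lemma horizontal_link i j (k : 'I_3) (v : G) : val k = 1%N -> v \in link i j k ->
  (grid_pos v).2 = (level i j)%:R.
Proof.
by move=> k1; rewrite /link /link_src /link_tgt k1 !inE => /orP[] /eqP->.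
Qed.

Lemma vertical_link i j (k : 'I_3) (v : G) : val k = 2%N -> v \in link i j k ->
  (grid_pos v).1 = (column i j)%:R.
Proof.
move=> k2; rewrite /link /link_src /link_tgt k2 !inE => /orP[] /eqP-> //=.
by rewrite columnC.
Qed.

(** A common vertex would be a port, left of all columns, or the bend of the horizontal link, which
    is in another column. *)
Lemma hv_not_adjacent i j (a : 'I_3) k l (b : 'I_3) p (v : G) :
  val a = 1%N -> val b = 2%N -> hv_crossing i j k l p ->
  v \in link i j a -> v \in link k l b -> False.
Proof.
move=> a1 b2 [_ ne] va /(vertical_link b2); move: va.
have := column_gt0 k l.
rewrite /link /link_src /link_tgt a1 !inE => c0 /orP[] /eqP-> /=; first by lra.
by move/eqP; rewrite eqr_nat => /eqP.
Qed.

Lemma grid_simple : is_simple D.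
Proof.
split=> e f /edge_linkP[i [j [a [ij ->]]]] /edge_linkP[k [l [b [kl ->]]]].
  move=> [ne [v [ve vf]]] [_ [p]] /(link_crossing ij kl ne)[] [h1 h2 hp].
    exact: hv_not_adjacent hp ve vf.
  exact: hv_not_adjacent hp vf ve.
move=> ne p q /(link_crossing ij kl ne) [] [h1 h2 hp]
  /(link_crossing ij kl ne)[] [h3 h4 hq].
- by rewrite hp.1 hq.1.
- by move: h3; rewrite h1.
- by move: h3; rewrite h1.
- by rewrite hp.1 hq.1.
Qed.

Lemma grid_right_angle : right_angle_crossings D.
Proof.
move=> x y z w /adj_linkP[i [j [a [ij exy]]]] /adj_linkP[k [l [b [kl ezw]]]].
have xe : x \in link i j a by rewrite -exy !inE eqxx.
have ye : y \in link i j a by rewrite -exy !inE eqxx orbT.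
have ze : z \in link k l b by rewrite -ezw !inE eqxx.
have we : w \in link k l b by rewrite -ezw !inE eqxx orbT.
rewrite exy ezw => -[ne [p]] /(link_crossing ij kl ne)[] [h1 h2 _]; rewrite /dot/=.
  rewrite (horizontal_link h1 xe) (horizontal_link h1 ye).
  by rewrite (vertical_link h2 ze) (vertical_link h2 we); ring.
rewrite (vertical_link h1 xe) (vertical_link h1 ye).
by rewrite (horizontal_link h2 ze) (horizontal_link h2 we); ring.
Qed.

Lemma subdivided_RAC : RAC R G.
Proof.
exists D; split; [exact: grid_drawingP|exact: grid_simple|exact: grid_straight|].
exact: grid_right_angle.
Qed.

End GridDrawing.

Theorem theorem4 (R : realType) :
  exists G : sgraph, RAC R G /\ ~ fan_crossing R G.
Proof.
exists (subdivided 501); split; first exact: subdivided_RAC.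
exact: subdivided_not_fan_crossing.
Qed.
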